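(* Let $k\ge 2$ and let $G$ be a $k$-uniform hypergraph on $n\ge 2$ vertices whose degrees, listed in non-increasing order, are $d_1\ge d_2\ge\cdots\ge d_n$. Put $\Delta=d_1$ (maximum degree) and $\Delta'=d_2$ (second maximum degree), and assume $\Delta'\ge 1$. Let $0\le\alpha<1$ and \[h(t)=(1-\alpha)\Delta' t^{k}+\alpha(\Delta'-\Delta)t^{k-1}-(1-\alpha)\Delta .\] Define $\delta$ as follows: if $\alpha=0$, let $\delta=(\Delta/\Delta')^{1/k}$; if $0<\alpha<1$ and $\Delta=\Delta'$, let $\delta=1$; if $0<\alpha<1$ and $\Delta>\Delta'$, let $\delta$ be any root of $h(t)=0$ in the interval $((\Delta/\Delta')^{1/k},+\infty)$ (such a root exists). Then \[\rho_\alpha(G)\le \alpha\Delta+(1-\alpha)\Delta\,\delta^{-(k-1)}.\] Moreover, if $G$ is connected, equality holds if and only if either $G$ is regular, or $G\cong G'$, where $H$ is a regular $(k-1)$-uniform hypergraph on $n-1$ vertices, $v\notin V(H)$, $V(G')=V(H)\cup\{v\}$ and $E(G')=\{e\cup\{v\}: e\in E(H)\}$.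
   Context: Hypergraphs are finite, with edges being sets (no repeated edges). A hypergraph is $k$-uniform if every edge has exactly $k$ vertices. The degree $d_v$ of a vertex $v$ is the number of edges containing $v$; $G$ is regular if all vertices have the same degree. For a $k$-uniform hypergraph $G$ with vertex set $\{1,\dots,n\}$, the adjacency tensor $\mathcal A(G)$ is the order-$k$, dimension-$n$ tensor whose $(i_1,\dots,i_k)$-entry is $\frac{1}{(k-1)!}$ if $\{i_1,\dots,i_k\}\in E(G)$ and $0$ otherwise; $\mathcal D(G)$ is the diagonal order-$k$ tensor with $(i,\dots,i)$-entry $d_i$. For $0\le\alpha<1$, $\mathcal A_\alpha(G)=\alpha\mathcal D(G)+(1-\alpha)\mathcal A(G)$. For an order-$k$, dimension-$n$ tensor $\mathcal T$ and $x\in\mathbb C^n$, $(\mathcal Tx)_i=\sum_{i_2,\dots,i_k=1}^n\mathcal T_{ii_2\dots i_k}x_{i_2}\cdots x_{i_k}$; $\lambda\in\mathbb C$ is an eigenvalue of $\mathcal T$ if $\mathcal Tx=\lambda x^{[k-1]}$ for some nonzero $x$, where $x^{[k-1]}=(x_1^{k-1},\dots,x_n^{k-1})^\top$. The $\alpha$-spectral radius $\rho_\alpha(G)$ is the largest modulus of the eigenvalues of $\mathcal A_\alpha(G)$. A walk is an alternating sequence $(v_0,e_1,v_1,\dots,e_s,v_s)$ of vertices and edges with $v_{i-1},v_i\in e_i$ and $v_{i-1}\ne v_i$; a path is a walk with all vertices distinct and all edges distinct; $G$ is connected if any two vertices are joined by a path. *)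

(* Defs.v *)
(* Complex numbers are modelled by an arbitrary
   numClosedFieldType C (e.g. algC, or the complex numbers). *)
From HB Require Import structures.
From mathcomp Require Import all_boot all_order all_algebra.
Set Implicit Arguments. Unset Strict Implicit. Unset Printing Implicit Defensive.
Import Order.TTheory GRing.Theory Num.Theory.
Local Open Scope ring_scope.

Definition uniform (V : finType) (k : nat) (E : {set {set V}}) : Prop :=
  forall e, e \in E -> #|e| = k.

Definition deg (V : finType) (E : {set {set V}}) (v : V) : nat :=
  #|[set e in E | v \in e]|.

Definition regular (V : finType) (E : {set {set V}}) : Prop :=
  forall u v : V, deg E u = deg E v.

Definition sorted_degrees (n : nat) (E : {set {set 'I_n}}) : seq nat :=
  sort geq [seq deg E v | v <- enum 'I_n].

Definition maxdeg (n : nat) (E : {set {set 'I_n}}) : nat := nth 0%N (sorted_degrees E) 0.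
Definition maxdeg2 (n : nat) (E : {set {set 'I_n}}) : nat := nth 0%N (sorted_degrees E) 1.

Definition hadj (V : finType) (E : {set {set V}}) : rel V :=
  fun u v => (u != v) && [exists e in E, (u \in e) && (v \in e)].

Definition hconnected (V : finType) (E : {set {set V}}) : Prop :=
  forall u v : V, connect (hadj E) u v.

(* Order-k, dimension-n tensors: T i s is the entry (i, s_1, ..., s_{k-1}). *)
Definition tensor (C : Type) (n : nat) := 'I_n -> seq 'I_n -> C.

Definition tapply (C : numClosedFieldType) (k n : nat) (T : tensor C n)
  (x : 'I_n -> C) (i : 'I_n) : C :=
  \sum_(t : (k.-1).-tuple 'I_n) T i t * \prod_(j <- t) x j.

Definition teigenvalue (C : numClosedFieldType) (k n : nat) (T : tensor C n) (l : C) : Prop :=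
  exists x : 'I_n -> C, (exists i, x i != 0) /\
    forall i, tapply k T x i = l * x i ^+ k.-1.

Definition adj_tensor (C : numClosedFieldType) (k n : nat) (E : {set {set 'I_n}}) : tensor C n :=
  fun i s => if [set j in i :: s] \in E then (((k.-1)`!)%:R)^-1 else 0.

Definition deg_tensor (C : numClosedFieldType) (n : nat) (E : {set {set 'I_n}}) : tensor C n :=
  fun i s => if all (pred1 i) s then (deg E i)%:R else 0.

Definition Aalpha (C : numClosedFieldType) (k n : nat) (E : {set {set 'I_n}}) (a : C) : tensor C n :=
  fun i s => a * deg_tensor C E i s + (1 - a) * adj_tensor C k E i s.

Definition rho_le (C : numClosedFieldType) (k n : nat) (T : tensor C n) (B : C) : Prop :=
  forall l, teigenvalue k T l -> `|l| <= B.

Definition rho_eq (C : numClosedFieldType) (k n : nat) (T : tensor C n) (B : C) : Prop :=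
  rho_le k T B /\ exists l, teigenvalue k T l /\ `|l| = B.

Definition hiso (V W : finType) (E : {set {set V}}) (F : {set {set W}}) : Prop :=
  exists f : V -> W, bijective f /\ forall e : {set V}, (e \in E) = (f @: e \in F).

Definition cone (W : finType) (H : {set {set W}}) : {set {set option W}} :=
  [set (None |: ([set Some x | x in e] : {set option W})) | e : {set W} in H].

Definition hpoly (C : numClosedFieldType) (k : nat) (a D D' t : C) : C :=
  (1 - a) * D' * t ^+ k + a * (D' - D) * t ^+ k.-1 - (1 - a) * D.

Definition delta_ok (C : numClosedFieldType) (k : nat) (a D D' d : C) : Prop :=
  (a = 0 /\ d = k.-root (D / D'))
  \/ (0 < a /\ D = D' /\ d = 1)
  \/ (0 < a /\ D' < D /\ k.-root (D / D') < d /\ hpoly k a D D' d = 0).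

(* Main.v *)
(** Weigh a vertex [v] of maximum degree by [delta >= 1] and every other vertex
    by [1].  For a nonnegative tensor [T] and positive weights [y], comparing an
    eigenvector with [y] where the ratio of moduli is maximal bounds every
    eigenvalue by the largest [(T y)_i / y_i ^ (k-1)].  At [v] this quotient is
    exactly the claimed bound, and [h delta = 0] says that elsewhere it is at
    most the bound, with equality iff [deg i = Delta'] and, unless [delta = 1],
    every edge through [i] contains [v].  For connected hypergraphs an
    extremal eigenvector is proportional to [y] in modulus, so all quotients are
    equal: either [delta = 1] and [G] is regular, or every edge contains [v] and
    [G] is a cone.  Conversely, in both cases [y] itself is an eigenvector. *)
Require Import Defs.
From HB Require Import structures.
From mathcomp Require Import all_boot all_order all_algebra.
From mathcomp Require Import ring zify.
Import Order.TTheory GRing.Theory Num.Theory.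
Local Open Scope ring_scope.

(** * Sign changes and roots of real polynomials; invariance under conjugation encodes real
    coefficients *)

Lemma conj_poly_factor {C : numClosedFieldType} {p q r : {poly C}} :
  r != 0 -> map_poly Num.conj p = p -> map_poly Num.conj r = r -> p = q * r ->
  map_poly Num.conj q = q.
Proof.
move=> r0 pJ rJ pE; apply: (mulIf r0).
by rewrite -{1}rJ -rmorphM /= -pE pJ.
Qed.

(* Non-real roots come in conjugate pairs, which do not change the sign of a
   real polynomial; so a sign change has to come from a real root. *)
Lemma conj_poly_ivt {C : numClosedFieldType} {p : {poly C}} {u v : C} :
  map_poly Num.conj p = p -> u \is Num.real -> v \is Num.real -> u <= v ->
  p.[u] * p.[v] < 0 -> exists2 t, u <= t <= v & root p t.
Proof.
move=> + uR vR uv; have [m] := ubnP (size p); elim: m p => // m IHm p lepm pJ puv.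
have [z /factor_theorem [q pE]] : exists z, root p z.
  apply/closed_rootP; apply: contraTneq puv => /eqP/size_poly1P [c c0 pE].
  have cR : c \is Num.real.
    by apply/CrealP; move: pJ; rewrite pE map_polyC => /polyC_inj.
  by rewrite pE !hornerC -real_leNgt ?real0 ?rpredM // -expr2 real_exprn_even_ge0.
have p0 : p != 0 by apply: contraTneq puv => ->; rewrite horner0 mul0r ltxx.
(* A real non-constant factor [r] with the same sign at [u] and [v] can be divided out: the quotient
   [s] is smaller, still real, and still changes sign. *)
have reduce (r s : {poly C}) : p = s * r -> map_poly Num.conj r = r ->
    (1 < size r)%N -> 0 < r.[u] * r.[v] -> exists2 t, u <= t <= v & root p t.
  move=> prs rJ r1 ruv.
  have r0 : r != 0 by apply: contraTneq r1 => ->; rewrite size_poly0.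
  have s0 : s != 0 by apply: contraNneq p0; rewrite prs => ->; rewrite mul0r.
  have [|||t tuv st] := IHm s => //.
  - move: lepm; rewrite prs size_mul // => lepm.
    have : (0 < size s)%N by rewrite size_poly_gt0.
    by move: (size s) (size r) r1 lepm => *; lia.
  - exact: (conj_poly_factor r0 pJ rJ prs).
  - by move: puv; rewrite prs !hornerM mulrACA (pmulr_llt0 _ ruv).
  - by exists t => //; rewrite prs rootM st.
have [zR|zR] := boolP (z \is Num.real).
  have [zI|zI] := boolP (u <= z <= v).
    by exists z => //; rewrite pE rootM root_XsubC eqxx orbT.
  apply: reduce pE _ _ _; rewrite ?size_XsubC //.
    by rewrite map_polyXsubC /= conj_Creal.
  (* A real root outside the interval gives a linear factor with the same sign at both ends. *)
  rewrite !hornerXsubC.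
  have [uz|zu] := real_leP uR zR; last first.
    by rewrite mulr_gt0 ?subr_gt0 // (lt_le_trans zu).
  rewrite uz /= -real_ltNge // in zI.
  by rewrite nmulr_rgt0 ?subr_lt0 // (le_lt_trans uv).
have zJ : z^* != z by apply: contra zR => /eqP/CrealP.
have /factor_theorem [s qE] : root q z^*.
  have : root p z^* by rewrite -pJ fmorph_root pE rootM root_XsubC eqxx orbT.
  by rewrite pE rootM root_XsubC (negPf zJ) orbF.
(* At real [w] this product is the squared modulus of [w - z], nonzero because [z] is not real. *)
have norm_gt0 w : w \is Num.real -> 0 < (w - z^*) * (w - z).
  move=> wR; have -> : w - z^* = (w - z)^* by rewrite rmorphB /= (conj_Creal wR).
  rewrite mulrC mul_conjC_gt0 subr_eq0.
  by apply: contraNneq zR => <-.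
apply: (reduce (('X - (z^* )%:P) * ('X - z%:P)) s).
- by rewrite mulrA -qE.
- by rewrite rmorphM /= !map_polyXsubC /= conjCK mulrC.
- by rewrite size_mul ?polyXsubC_eq0 // !size_XsubC.
by rewrite !hornerM !hornerXsubC mulr_gt0 ?norm_gt0.
Qed.

(** * The tensor action as a sum over edges *)

Section Tuples.
Context {n m : nat} {e : {set 'I_n}} {i : 'I_n}.
Hypotheses (card_e : #|e| = m.+1) (ie : i \in e).

(** Since [e] has [m.+1] elements including [i], the [m] entries of [t] must use up [e :\ i] without
    repetition. *)
Lemma set_cons_tuple (t : m.-tuple 'I_n) :
  ([set j in i :: t] == e) = all (mem (e :\ i)) t && uniq t.
Proof.
apply/eqP/andP => [eE | [/allP te ut]].
  have /= /andP [it ut] : uniq (i :: t).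
    by apply/card_uniqP; rewrite -cardsE eE card_e /= size_tuple.
  split=> //; apply/allP => j jt; rewrite !inE -eE !inE jt orbT andbT.
  by apply: contraNneq it => <-.
apply/eqP; rewrite eqEcard card_e; apply/andP; split.
  apply/subsetP => j; rewrite !inE => /predU1P [-> // | /te].
  by rewrite !inE => /andP [].
have it : i \notin t by apply/negP => /te; rewrite !inE eqxx.
by rewrite cardsE (@card_uniqP _ (i :: t) _) /= ?size_tuple // it.
Qed.

(** The admissible tuples are the orderings of [e :\ i], all with the same product; their number
    cancels the factor 1/(k-1)! in the adjacency tensor. *)
Lemma sum_prod_tuple (C : comNzRingType) (x : 'I_n -> C) :
  \sum_(t : m.-tuple 'I_n | [set j in i :: t] == e) \prod_(j <- t) x j =
  (m`!)%:R * \prod_(j in e :\ i) x j.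
Proof.
have card_ei : #|e :\ i| = m by move: (cardsD1 i e); rewrite ie card_e => -[].
transitivity (\sum_(t : m.-tuple 'I_n | all (mem (e :\ i)) t && uniq t)
   \prod_(j in e :\ i) x j).
  apply: eq_big => [t | t]; first exact: set_cons_tuple.
  rewrite set_cons_tuple => /andP [/allP te ut].
  rewrite -(big_enum _ _ (e :\ i)) /=; apply: perm_big.
  apply: uniq_perm => //; first exact: enum_uniq.
  case: (@uniq_min_size _ t (enum (e :\ i)) ut) => //.
    by move=> j /te; rewrite mem_enum.
  by rewrite -cardE card_ei size_tuple.
have := card_uniq_tuples m (mem (e :\ i)).
by rewrite sumr_const mulr_natl card_ei ffactnn cardsE => <-.
Qed.
End Tuples.

(** The diagonal part survives only at the constant tuple with entries [i]; in the adjacency part,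
    tuples are grouped by the edge that they form together with [i]. *)
Lemma tapply_Aalpha {C : numClosedFieldType} {k n : nat} {E : {set {set 'I_n}}}
    (a : C) (x : 'I_n -> C) (i : 'I_n) : (2 <= k)%N -> uniform k E ->
  tapply k (Aalpha k E a) x i =
  a * (deg E i)%:R * x i ^+ k.-1 +
  (1 - a) * \sum_(e in E | i \in e) \prod_(j in e :\ i) x j.
Proof.
case: k => [|[|k]] //= _ unifE; rewrite /tapply /Aalpha /=.
under eq_bigr do rewrite mulrDl.
rewrite big_split /=; congr (_ + _).
  rewrite (bigD1 (nseq_tuple k.+1 i)) //= [X in _ + X]big1 ?addr0 => [|t tN].
    by rewrite /deg_tensor /= eqxx all_pred1_nseq big_cons big_nseq iter_mulr_1
       -exprS.
  rewrite /deg_tensor; case: ifP => [|_]; last by rewrite mulr0 mul0r.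
  move=> /all_pred1P tE; case/eqP: tN; apply: val_inj.
  by rewrite /= tE size_tuple.
under eq_bigr do rewrite -mulrA.
rewrite -mulr_sumr; congr (_ * _).
rewrite (bigID (fun t : k.+1.-tuple 'I_n => [set j in i :: t] \in E)) /=.
rewrite [X in _ + X]big1 ?addr0; last first.
  by move=> t /negPf tE; rewrite /adj_tensor tE mul0r.
rewrite (partition_big (fun t : k.+1.-tuple 'I_n => [set j in i :: t])
  (fun e => (e \in E) && (i \in e))) /=; last first.
  by move=> t ->; rewrite !inE eqxx.
apply: eq_bigr => e /andP [eE ie].
transitivity (((k.+1)`!)%:R^-1 *
  \sum_(t : k.+1.-tuple 'I_n | [set j in i :: t] == e) \prod_(j <- t) x j : C).
  rewrite mulr_sumr; apply: eq_big => [t | t /andP [tE _]].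
    by case: eqP => [->|]; rewrite ?eE ?andbF.
  by rewrite /adj_tensor tE.
rewrite (sum_prod_tuple (unifE _ eE) ie) mulKf // pnatr_eq0.
by rewrite -lt0n fact_gt0.
Qed.

(** * Nonnegative tensors: monotonicity and comparison with positive weights *)

Section Nonnegative.
Context {C : numClosedFieldType} {k n : nat} {T : tensor C n}.
Hypothesis T_ge0 : forall i s, 0 <= T i s.

Lemma tapply_scale (c : C) (x : 'I_n -> C) (i : 'I_n) :
  tapply k T (fun j => c * x j) i = c ^+ k.-1 * tapply k T x i.
Proof.
rewrite /tapply mulr_sumr; apply: eq_bigr => t _.
rewrite mulrCA; congr (_ * _); rewrite big_split /=; congr (_ * _).
by rewrite big_tuple prodr_const card_ord.
Qed.

Lemma ler_tapply (x y : 'I_n -> C) (i : 'I_n) :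
  (forall j, 0 <= x j <= y j) -> tapply k T x i <= tapply k T y i.
Proof.
move=> xy; apply: ler_sum => t _; apply: ler_wpM2l => //.
by apply: ler_prod => j _.
Qed.

Lemma normr_tapply (x : 'I_n -> C) (i : 'I_n) :
  `|tapply k T x i| <= tapply k T (fun j => `|x j|) i.
Proof.
apply: le_trans (ler_norm_sum _ _ _) _; apply: ler_sum => t _.
by rewrite normrM normr_prod ger0_norm.
Qed.
End Nonnegative.

Lemma Aalpha_ge0 {C : numClosedFieldType} {k n : nat} {E : {set {set 'I_n}}} {a : C} :
  0 <= a -> a < 1 -> forall i s, 0 <= Aalpha k E a i s.
Proof.
move=> a0 a1 i s; rewrite /Aalpha /deg_tensor /adj_tensor.
apply: addr_ge0; apply: mulr_ge0 => //; first by case: ifP.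
  by rewrite subr_ge0 ltW.
by case: ifP => // _; rewrite invr_ge0 ler0n.
Qed.

Section Weights.
Context {C : numClosedFieldType} {k n : nat} {E : {set {set 'I_n}}} {a : C}.
Hypotheses (k_ge2 : (2 <= k)%N) (unifE : uniform k E) (a_ge0 : 0 <= a) (a_lt1 : a < 1).
Let T := Aalpha k E a.

(** Each edge product for [z] is at most the one for [y], and [a < 1] keeps the adjacency part, so
    equality of the sums holds edge by edge; positivity of [y] then makes every factor agree. *)
Lemma tapply_eq_edge (z y : 'I_n -> C) (i : 'I_n) :
  (forall j, 0 < y j) -> (forall j, 0 <= z j <= y j) -> z i = y i ->
  tapply k T z i = tapply k T y i ->
  forall e, e \in E -> i \in e -> forall j, j \in e -> z j = y j.
Proof.
have a1 : 1 - a != 0 by rewrite subr_eq0 gt_eqF.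
move=> y0 zy zi; rewrite !tapply_Aalpha // zi => /addrI/(mulfI a1) eqS.
move=> e eE ie j je; have [->//|ji] := eqVneq j i.
have : \sum_(e in E | i \in e)
    (\prod_(j in e :\ i) y j - \prod_(j in e :\ i) z j) = 0.
  by rewrite sumrB eqS subrr.
move/psumr_eq0P => /(_ _ e); rewrite eE ie => /(_ _ isT) He.
have {He} /eqP : \prod_(j in e :\ i) y j - \prod_(j in e :\ i) z j = 0.
  by apply: He => f _; rewrite subr_ge0; apply: ler_prod.
have jei : j \in e :\ i by rewrite !inE ji.
rewrite subr_eq0 (bigD1 j) //= [X in _ == X](bigD1 j) //= => /eqP prodE.
have [z0 zj] := andP (zy j); apply: le_anti; rewrite zj /=.
have P0 : 0 < \prod_(l in e :\ i | l != j) y l by apply: prodr_gt0.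
rewrite -(ler_pM2r P0) prodE; apply: ler_wpM2l => //.
exact: ler_prod.
Qed.

(* Compares the eigenvector with [y] at a vertex where the ratio of moduli is
   maximal; in case of equality, maximality propagates along edges. *)
Lemma teigenvalue_weight_bound {y : 'I_n -> C} {B l : C} :
  (forall i, 0 < y i) -> (forall i, tapply k T y i <= B * y i ^+ k.-1) ->
  teigenvalue k T l ->
  `|l| <= B /\
  (`|l| = B -> hconnected E -> forall i, tapply k T y i = B * y i ^+ k.-1).
Proof.
move=> y0 yB [x [[i0 xi0] eigx]].
have T0 : forall i s, 0 <= T i s by apply: Aalpha_ge0.
pose F j := `|x j| / y j.
have F0 j : 0 <= F j by rewrite divr_ge0 // ltW.
have [||i _ Fmax] := @real_arg_maxP C _ i0 predT F; rewrite //.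
  by move=> j _; apply: ger0_real.
pose m := F i.
have m0 : 0 < m.
  by apply: lt_le_trans (Fmax i0 isT); rewrite divr_gt0 // normr_gt0.
(* Dividing by the maximal ratio [m] puts the moduli below [y], with contact at [i]. *)
pose z j := m^-1 * `|x j|.
have zy j : 0 <= z j <= y j.
  rewrite mulr_ge0 ?invr_ge0 ?(ltW m0) //= /z mulrC ler_pdivrMr //.
  by rewrite mulrC -ler_pdivrMr //; apply: Fmax.
have zi : z i = y i.
  rewrite /z /m /F invf_div divfK //; apply: contraTneq m0 => xi.
  by rewrite /m /F xi mul0r ltxx.
have lz j : `|l| * z j ^+ k.-1 <= tapply k T z j.
  rewrite tapply_scale // exprMn mulrCA ler_wpM2l //.
    by rewrite exprn_ge0 // invr_ge0 ltW.
  by rewrite -normrX -normrM -eigx; apply: normr_tapply.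
(* At any contact vertex, [|l| y^(k-1) <= T z <= T y <= B y^(k-1)]. This chain gives the bound, and
   it collapses to equalities when [|l| = B]. *)
have row j : z j = y j -> `|l| * y j ^+ k.-1 <= tapply k T z j <= B * y j ^+ k.-1.
  by move=> zj; rewrite -{1}zj lz (le_trans _ (yB j)) // ler_tapply.
split.
  by have /andP [/le_trans h /h] := row i zi; rewrite ler_pM2r // exprn_gt0.
move=> lB conn.
have rowE j : z j = y j -> tapply k T z j = B * y j ^+ k.-1.
  by move=> /row; rewrite lB => h; apply/esym/le_anti.
have rowE' j : z j = y j -> tapply k T y j = B * y j ^+ k.-1.
  move=> zj; apply: le_anti; rewrite yB -rowE //=; exact: ler_tapply.
suff zE j : z j = y j by move=> j; apply: rowE'.
have /connectP [p pth ->] := conn i j.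
elim: p (i) zi pth => //= j' p IHp i' zi' /andP [/andP [_ /existsP [e]]].
case/and3P => eE i'e j'e; apply: IHp.
apply: (@tapply_eq_edge z y i' y0 zy zi' _ e) => //.
by rewrite rowE ?rowE'.
Qed.
End Weights.

(** * The two largest degrees *)

Lemma nth0_sort_geq_ub (s : seq nat) (m : nat) :
  m \in s -> (m <= nth 0%N (sort geq s) 0)%N.
Proof.
have tot : total geq by move=> x y; apply: leq_total.
have tr : transitive geq by move=> x y z /= yx xz; apply: leq_trans xz yx.
rewrite -(mem_sort geq); move: (sort_sorted tot s).
case: (sort geq s) => //= x t /(order_path_min tr) /allP tx.
by rewrite inE => /predU1P [-> | /tx].
Qed.

Section MaxDegree.
Context {n : nat} {E : {set {set 'I_n}}} {v : 'I_n}.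
Hypothesis max_v : forall u, (deg E u <= deg E v)%N.

(** A sorted list is determined by its multiset of entries. Hence [maxdeg2] is the largest degree
    among the vertices other than [v], also when the maximum is attained several times. *)
Lemma sorted_degrees_max :
  sorted_degrees E = deg E v :: sort geq [seq deg E u | u <- rem v (enum 'I_n)].
Proof.
have tot : total geq by move=> x y; apply: leq_total.
have tr : transitive geq by move=> x y z /= yx xz; apply: leq_trans xz yx.
apply: (sorted_eq tr); first by move=> x y /=; rewrite andbC => /anti_leq.
- exact: sort_sorted.
- rewrite /= path_min_sorted ?sort_sorted //.
  by apply/allP => m; rewrite mem_sort => /mapP [u _ ->] /=.
rewrite /sorted_degrees perm_sort perm_sym.
have pe : perm_eq (enum 'I_n) (v :: rem v (enum 'I_n)).
  by apply: perm_to_rem; rewrite mem_enum.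
by rewrite perm_sym (permPl (perm_map _ pe)) /= perm_cons perm_sym perm_sort.
Qed.

Lemma maxdeg_max : maxdeg E = deg E v.
Proof. by rewrite /maxdeg sorted_degrees_max. Qed.

Lemma deg_le_maxdeg2 (u : 'I_n) : u != v -> (deg E u <= maxdeg2 E)%N.
Proof.
move=> uv; rewrite /maxdeg2 sorted_degrees_max /=; apply: nth0_sort_geq_ub.
by apply: map_f; rewrite mem_rem_uniq ?enum_uniq // inE uv mem_enum.
Qed.

Lemma maxdeg2_attained : (2 <= n)%N -> exists2 u, u != v & deg E u = maxdeg2 E.
Proof.
move=> n2; rewrite /maxdeg2 sorted_degrees_max /=.
set s := [seq _ | _ <- _]; have : nth 0%N (sort geq s) 0 \in s.
  (* As [n >= 2], some vertex besides [v] remains, so the head is a genuine entry and not the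
     default 0. *)
  rewrite -(mem_sort geq) mem_nth // size_sort size_map size_rem ?mem_enum //.
  by rewrite size_enum_ord -subn1 subn_gt0.
case/mapP => u; rewrite mem_rem_uniq ?enum_uniq // => /andP [uv _] ->.
by exists u.
Qed.
End MaxDegree.

(** * The tensor applied to the apex weight *)

Lemma sum_edges_const {C : nzRingType} {n : nat} (E : {set {set 'I_n}}) (i : 'I_n) (c : C) :
  \sum_(e in E | i \in e) c = (deg E i)%:R * c.
Proof.
rewrite mulr_natl /deg -sumr_const; apply: eq_bigl => e.
by rewrite inE.
Qed.

Definition cone_weight {C : nzRingType} {n : nat} (d : C) (v j : 'I_n) : C :=
  if j == v then d else 1.

Section ConeWeight.
Context {C : numClosedFieldType} {k n : nat} {E : {set {set 'I_n}}} {a d : C} {v : 'I_n}.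
Hypotheses (k_ge2 : (2 <= k)%N) (unifE : uniform k E).
Let T := Aalpha k E a.

Lemma prod_cone_weight (A : {set 'I_n}) :
  \prod_(j in A) cone_weight d v j = if v \in A then d else 1.
Proof.
case: ifP => vA.
  rewrite (bigD1 v) //= /cone_weight eqxx big1 ?mulr1 // => j /andP [_ /negPf ->].
  by [].
rewrite big1 // => j jA; rewrite /cone_weight; case: eqP => // jv.
by rewrite -jv jA in vA.
Qed.

Lemma tapply_cone_weight_apex :
  tapply k T (cone_weight d v) v =
  a * (deg E v)%:R * d ^+ k.-1 + (1 - a) * (deg E v)%:R.
Proof.
rewrite tapply_Aalpha // {1}/cone_weight eqxx; congr (_ + _ * _).
rewrite -[RHS]mulr1 -sum_edges_const; apply: eq_bigr => e _.
by rewrite prod_cone_weight !inE eqxx.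
Qed.

(** The gap splits into a degree deficit at [i] and a contribution [d - 1] from each edge through
    [i] that misses [v]. For [d >= 1] and [deg E i <= D'] both parts are nonnegative, so a zero gap
    annihilates each of them. *)
Lemma tapply_cone_weight_base (i : 'I_n) (D' : C) : i != v ->
  a * D' + (1 - a) * D' * d - tapply k T (cone_weight d v) i =
  (a + (1 - a) * d) * (D' - (deg E i)%:R) +
  (1 - a) * \sum_(e in E | i \in e) (d - if v \in e then d else 1).
Proof.
move=> iv; rewrite tapply_Aalpha // {1}/cone_weight (negPf iv) expr1n.
rewrite sumrB sum_edges_const.
under eq_bigr do rewrite prod_cone_weight !inE eq_sym iv /=.
ring.
Qed.
End ConeWeight.

(** * The parameter delta and the polynomial h *)

Section Delta.
Context {C : numClosedFieldType} {k : nat} {a D D' : C}.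
Hypotheses (k_ge2 : (2 <= k)%N) (a_ge0 : 0 <= a) (a_lt1 : a < 1).
Hypotheses (D'_ge1 : 1 <= D') (D'_le : D' <= D).
Let k_gt0 : (0 < k)%N := ltnW k_ge2.
Let D'_gt0 : 0 < D' := lt_le_trans ltr01 D'_ge1.

Lemma delta_ok_ge1 {d : C} : delta_ok k a D D' d -> 1 <= d.
Proof.
have r1 : 1 <= k.-root (D / D') by rewrite rootC_ge1 // ler_pdivlMr ?mul1r.
by case=> [[_ ->] | [[_ [_ ->]] | [_ [_ [/ltW rd _]]]]] //; apply: le_trans rd.
Qed.

(** Together with [1 <= d], this equation is all that the bound and its equality case use of the
    three-way choice of delta. *)
Lemma delta_ok_root {d : C} : delta_ok k a D D' d -> hpoly k a D D' d = 0.
Proof.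
rewrite /hpoly; case=> [[-> ->] | [[_ [-> ->]] | [_ [_ [_ //]]]]].
  rewrite rootCK // subr0 !mul0r addr0 !mul1r mulrC divfK ?subrr //.
  by rewrite gt_eqF.
by rewrite !expr1n subrr mulr0 mul0r addr0 mulr1 subrr.
Qed.

(** Dividing [hpoly k a D D' d = 0] by [d ^+ k.-1] equates the row quotient at the apex with that at
    a vertex of degree [D'] all of whose edges contain the apex. *)
Lemma hpoly_div {d : C} : 0 < d ->  hpoly k a D D' d = 0 ->
  a * D + (1 - a) * D / d ^+ k.-1 = a * D' + (1 - a) * D' * d.
Proof.
move=> d0 hd; have dk0 : d ^+ k.-1 != 0 by rewrite expf_neq0 // gt_eqF.
apply: (mulIf dk0); rewrite mulrDl divfK //.
move: hd; rewrite /hpoly -{1}(prednK k_gt0) exprS => hd.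
apply/eqP; rewrite eq_sym -subr_eq0 -hd; apply/eqP; ring.
Qed.

Lemma hpoly1 : hpoly k a D D' 1 = D' - D.
Proof. rewrite /hpoly !expr1n; ring. Qed.

(** The middle term of [hpoly] vanishes and [d ^+ k = 1] remains. *)
Lemma hpoly_diag {d : C} : D = D' -> 1 <= d -> hpoly k a D D' d = 0 -> d = 1.
Proof.
move=> -> d1; rewrite /hpoly subrr mulr0 mul0r addr0 => /eqP.
rewrite subr_eq0 -[X in _ == X]mulr1 => /eqP/mulfI h; apply/eqP.
rewrite -(@pexpr_eq1 _ d k) // ?(le_trans ler01) //; apply/eqP/h.
by rewrite mulf_neq0 ?gt_eqF // subr_gt0.
Qed.

Lemma hpoly_root_exists : 0 < a -> D' < D ->
  exists t : C, k.-root (D / D') < t /\ hpoly k a D D' t = 0.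
Proof.
move=> a0 ltD.
pose p : {poly C} := ((1 - a) * D')%:P * 'X^k + (a * (D' - D))%:P * 'X^(k.-1)
  - ((1 - a) * D)%:P.
have pE t : p.[t] = hpoly k a D D' t by rewrite !hornerE.
have conj_ge0 (x : C) : 0 <= x -> x^* = x by move=> /ger0_real/CrealP.
have D0 : 0 < D := lt_trans D'_gt0 ltD.
have pJ : map_poly Num.conj p = p.
  rewrite !(rmorphB, rmorphD, rmorphM) /= !map_polyC !map_polyXn /= rmorph1.
  by rewrite (conj_ge0 a) // (conj_ge0 D') ?(conj_ge0 D) ?ltW // /p ?polyCM ?polyCB.
(* The sign change is sought between [r] and [t]. The choice of [t] gives
   [(1 - a) * t = D + a * D + (1 - a)], which absorbs the negative term [a * (D' - D)] and still
   leaves at least [D]. *)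
pose r := k.-root (D / D'); pose t := (D + a * D) / (1 - a) + 1.
have b0 : 0 < 1 - a by rewrite subr_gt0.
have D1 : 1 < D := le_lt_trans D'_ge1 ltD.
have r1 : 1 < r by rewrite rootC_gt1 // ltr_pdivlMr ?mul1r.
have rk : r ^+ k = D / D' by rewrite rootCK.
have rD : r <= D.
  apply: (@le_trans _ _ (r ^+ k)); first by rewrite ler_eXnr // ltW.
  by rewrite rk ler_pdivrMr // ler_peMr // ltW.
(* At [r] the first and last terms cancel, leaving the negative middle term. *)
have hr : hpoly k a D D' r < 0.
  rewrite /hpoly rk.
  have -> : (1 - a) * D' * (D / D') = (1 - a) * D.
    by rewrite -mulrA [D' * _]mulrC divfK ?gt_eqF.
  rewrite addrAC subrr add0r nmulr_rlt0 ?exprn_gt0 ?(lt_trans _ r1) //.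
  by rewrite pmulr_rlt0 ?subr_lt0.
have Dt : D < t.
  rewrite /t; apply: (@le_lt_trans _ _ ((D + a * D) / (1 - a))).
    rewrite ler_pdivlMr //; apply: (@le_trans _ _ D).
      by rewrite ler_piMr ?gerBl // ltW.
    by rewrite lerDl mulr_ge0 // ltW.
  by rewrite ltrDl.
have ht : 0 < hpoly k a D D' t.
  rewrite /hpoly -{1}(prednK k_gt0) exprS mulrA -mulrDl.
  have h1 : D <= (1 - a) * D' * t + a * (D' - D).
    apply: (@le_trans _ _ ((1 - a) * t + a * (D' - D))); last first.
      rewrite lerD2r; apply: ler_wpM2r; first by apply: ltW; apply: lt_trans Dt.
      by rewrite ler_peMr // ltW.
    rewrite /t mulrDr mulrC divfK ?gt_eqF // mulr1 mulrBr.
    rewrite -subr_ge0 [X in 0 <= X](_ : _ = 1 - a + a * D'); last by ring.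
    by rewrite addr_ge0 ?mulr_ge0 // ltW.
  have h2 : 1 <= t ^+ k.-1 by apply: exprn_ege1; apply: ltW; apply: lt_trans Dt.
  rewrite subr_gt0; apply: (@lt_le_trans _ _ D).
    by rewrite gtr_pMl // gtrBl.
  by apply: (le_trans h1); rewrite ler_peMr // (le_trans _ h1) // ltW.
have [|||//|s /andP [rs _] /eqP] := @conj_poly_ivt C p r t pJ.
- by apply: ger0_real; rewrite ltW // (lt_trans _ r1).
- by apply: ger0_real; rewrite ltW // (lt_trans _ Dt).
- by rewrite (le_trans rD) // ltW.
- by rewrite !pE nmulr_rlt0.
rewrite pE => hs; exists s; split=> //; rewrite lt_neqAle rs andbT.
by rewrite -/r; apply: contraTneq hr => ->; rewrite hs ltxx.
Qed.
End Delta.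

(** * Cones and hypergraphs with a vertex common to all edges *)

Lemma cone_of_apex {n k r : nat} {E : {set {set 'I_n}}} {v : 'I_n} :
  uniform k E -> (forall e, e \in E -> v \in e) ->
  (forall i, i != v -> deg E i = r) ->
  exists H : {set {set 'I_n.-1}}, uniform k.-1 H /\ regular H /\ hiso E (cone H).
Proof.
move=> unifE vE degE.
pose up (s : {set 'I_n.-1}) := v |: (lift v @: s).
have v_up s : v \notin lift v @: s.
  by apply/imsetP => -[j _ /eqP]; rewrite (negPf (neq_lift v j)).
have up_inj : injective up.
  move=> s t /(congr1 (fun A => A :\ v)); rewrite !setU1K //.
  exact/imset_inj/lift_inj.
have lift_up j s : (lift v j \in up s) = (j \in s).
  by rewrite !inE eq_sym (negPf (neq_lift v j)) mem_imset //; apply: lift_inj.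
(* [H] is the link of [v], with the other vertices renumbered through [lift v]; the isomorphism
   [unlift v] sends [v] to the apex [None]. *)
pose H := [set s | up s \in E].
have upE e : e \in E -> exists2 s, s \in H & e = up s.
  move=> eE; have eU : e = up [set j | lift v j \in e].
    apply/setP => i; have [j ->|->] := unliftP v i; first by rewrite lift_up inE.
    by rewrite vE // !inE eqxx.
  by exists [set j | lift v j \in e]; rewrite // inE -eU.
exists H; split; first move=> s; first rewrite inE => /unifE <-.
  by rewrite cardsU1 v_up card_imset //; apply: lift_inj.
split.
  suff degH j : deg H j = r by move=> i j; rewrite !degH.
  rewrite -(degE (lift v j)) 1?eq_sym ?neq_lift // /deg -(card_imset _ up_inj).
  apply: eq_card => e; rewrite inE; apply/imsetP/andP => [[s] | [eE je]].
    by rewrite !inE => /andP [sH js] ->; rewrite lift_up.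
  have [s sH eS] := upE e eE; exists s => //.
  by rewrite inE sH -(lift_up j s) -eS.
have f_bij : bijective (unlift v).
  exists (fun o => if o is Some j then lift v j else v) => [i | [j|]].
  - by case: unliftP.
  - by rewrite liftK.
  - by rewrite unlift_none.
exists (unlift v); split=> // e.
have f_up s : unlift v @: up s = None |: (Some @: s).
  rewrite imsetU1 unlift_none -imset_comp; congr (_ |: _).
  by apply: eq_imset => j /=; rewrite liftK.
apply/idP/imsetP => [/upE [s sH ->] | [s sH]]; first by exists s.
rewrite -[RHS]f_up => /(imset_inj (bij_inj f_bij)) ->.
by rewrite inE in sH.
Qed.

(** The apex is the preimage of [None]. Edges through any other vertex correspond to edges of [H]
    through its image, so regularity of [H] transfers to these vertices. *)
Lemma apex_of_cone {V W : finType} {E : {set {set V}}} {H : {set {set W}}} :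
  regular H -> hiso E (cone H) -> exists v,
    (forall e, e \in E -> v \in e) /\
    (forall i j, i != v -> j != v -> deg E i = deg E j).
Proof.
move=> regH [f [f_bij fE]]; have [g fK gK] := f_bij.
have f_inj := can_inj fK; have g_inj := can_inj gK.
pose up (s : {set W}) : {set option W} := None |: [set Some x | x in s].
have up_inj : injective up.
  move=> s t /(congr1 (fun A => A :\ None)); rewrite !setU1K.
  - by apply/imset_inj => x y [].
  - by apply/imsetP => -[].
  - by apply/imsetP => -[].
have up_mem w s : (Some w \in up s) = (w \in s).
  by rewrite !inE mem_imset // => x y [].
exists (g None); split=> [e | i j iv jv].
  rewrite fE => /imsetP [s _ es]; rewrite -(mem_imset _ _ f_inj) gK es.
  by rewrite !inE eqxx.
suff degE i' w : f i' = Some w -> deg E i' = deg H w.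
  case fi: (f i) iv => [w|]; last by rewrite -fi fK eqxx.
  case fj: (f j) jv => [w'|]; last by rewrite -fj fK eqxx.
  by rewrite (degE _ _ fi) (degE _ _ fj) (regH w w').
move=> fi; rewrite /deg -(card_imset _ (imset_inj f_inj)).
rewrite -[RHS](card_imset _ up_inj); apply: eq_card => e.
apply/imsetP/imsetP => -[s]; rewrite inE => /andP [].
  rewrite fE => /imsetP [t tH st] is_ eE; exists t; last by rewrite eE st.
  by rewrite inE tH -up_mem -fi /up -st mem_imset.
move=> sH ws ->; have gs : f @: (g @: up s) = up s.
  by rewrite -imset_comp (eq_imset _ gK) imset_id.
exists (g @: up s) => //; rewrite inE fE gs.
rewrite -(mem_imset _ _ f_inj) gs fi up_mem ws andbT.
by apply/imsetP; exists s.
Qed.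

(** * The spectral bound and its equality case *)

Theorem theorem3p1 (C : numClosedFieldType) (k n : nat) (E : {set {set 'I_n}})
  (a : C) :
  (2 <= k)%N -> (2 <= n)%N -> uniform k E -> (1 <= maxdeg2 E)%N ->
  0 <= a -> a < 1 ->
  let D : C := (maxdeg E)%:R in
  let D' : C := (maxdeg2 E)%:R in
  (0 < a -> D' < D ->
     exists t : C, k.-root (D / D') < t /\ hpoly k a D D' t = 0) /\
  forall d : C, delta_ok k a D D' d ->
    let B := a * D + (1 - a) * D / d ^+ k.-1 in
    rho_le k (Aalpha k E a) B /\
    (hconnected E ->
      (rho_eq k (Aalpha k E a) B <->
        (regular E \/
         exists H : {set {set 'I_n.-1}},
           uniform k.-1 H /\ regular H /\ hiso E (cone H)))).
Proof.
move=> k2 n2 unifE d2 a0 a1 D D'.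
have D'1 : 1 <= D' by rewrite ler1n.
have [v0 max_v0] : exists v, forall u, (deg E u <= deg E v)%N.
  have [v _ max_v] := @arg_maxnP _ (Ordinal (ltnW n2)) predT (deg E) isT.
  by exists v => u; apply: max_v.
have D'D : D' <= D.
  have [u _ degu] := maxdeg2_attained max_v0 n2.
  by rewrite ler_nat (maxdeg_max max_v0) -degu.
split=> [|d d_ok B]; first exact: hpoly_root_exists.
have d1 : 1 <= d := delta_ok_ge1 k2 D'1 D'D d_ok.
have d_root := delta_ok_root k2 D'1 d_ok.
have d0 : 0 < d := lt_le_trans ltr01 d1.
have b0 : 0 < 1 - a by rewrite subr_gt0.
have BE : B = a * D' + (1 - a) * D' * d := hpoly_div k2 d0 d_root.
have B0 : 0 <= B by rewrite BE addr_ge0 ?mulr_ge0 // ltW.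
have w0 (v i : 'I_n) : 0 < cone_weight d v i by rewrite /cone_weight; case: ifP.
have apex_row v : (forall u, (deg E u <= deg E v)%N) ->
    tapply k (Aalpha k E a) (cone_weight d v) v = B * cone_weight d v v ^+ k.-1.
  move=> max_v; rewrite tapply_cone_weight_apex // -(maxdeg_max max_v).
  by rewrite /cone_weight eqxx /B [RHS]mulrDl divfK // expf_neq0 // gt_eqF.
have slack v i : i != v ->
    B * cone_weight d v i ^+ k.-1 - tapply k (Aalpha k E a) (cone_weight d v) i =
    (a + (1 - a) * d) * (D' - (deg E i)%:R) +
    (1 - a) * \sum_(e in E | i \in e) (d - if v \in e then d else 1).
  move=> iv; rewrite -(tapply_cone_weight_base k2 unifE) // -BE.
  by rewrite {1}/cone_weight (negPf iv) expr1n mulr1.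
have c0 : 0 < a + (1 - a) * d by rewrite ltr_wpDl // mulr_gt0.
have edge_ge0 v (e : {set 'I_n}) : 0 <= d - if v \in e then d else 1.
  by case: ifP; rewrite ?subrr ?subr_ge0.
have deg_ge0 v i : (forall u, (deg E u <= deg E v)%N) -> i != v ->
    0 <= D' - (deg E i)%:R.
  by move=> max_v iv; rewrite subr_ge0 ler_nat (deg_le_maxdeg2 max_v).
have rows v : (forall u, (deg E u <= deg E v)%N) -> forall i,
    tapply k (Aalpha k E a) (cone_weight d v) i <= B * cone_weight d v i ^+ k.-1.
  move=> max_v i; have [->|iv] := eqVneq i v; first by rewrite apex_row.
  rewrite -subr_ge0 slack // addr_ge0 // mulr_ge0 ?(ltW b0) ?(ltW c0) //.
    exact: deg_ge0 max_v iv.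
  exact: sumr_ge0.
have bound l := teigenvalue_weight_bound k2 unifE a0 a1 (l := l) (w0 v0) (rows v0 max_v0).
have rho : rho_le k (Aalpha k E a) B by move=> l /bound [].
split=> // conn.
(* Once both parts of the slack vanish, the weight itself is an eigenvector for [B]; the regular
   case and the cone case both end here. *)
have eigen v : (forall u, (deg E u <= deg E v)%N) ->
    (forall i, i != v -> (deg E i)%:R = D') ->
    (forall e, e \in E -> d = if v \in e then d else 1) ->
    rho_eq k (Aalpha k E a) B.
  move=> max_v degv edgev; split=> //; exists B; split; last exact: ger0_norm.
  exists (cone_weight d v); split; first by exists v; rewrite gt_eqF.
  move=> i; have [->|iv] := eqVneq i v; first by rewrite apex_row.
  apply/esym/eqP; rewrite -subr_eq0 slack // degv // subrr mulr0 add0r.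
  by rewrite big1 ?mulr0 // => e /andP [eE _]; rewrite -edgev // subrr.
have diag : D = D' -> d = 1 by move=> DD'; exact: (hpoly_diag k2 a1 D'1 DD' d1 d_root).
split=> [[_ [l [/bound [_ eqrow] /eqrow/(_ conn) rowE]]] | ].
  (* Every row is now an equality, so both nonnegative parts of the slack vanish. *)
  have {rowE} rowE i : i != v0 ->
      (deg E i)%:R = D' /\
      forall e, e \in E -> i \in e -> d = if v0 \in e then d else 1.
    move=> iv; have /esym/eqP := slack v0 i iv.
    rewrite rowE subrr paddr_eq0 ?mulr_ge0 ?(ltW b0) ?(ltW c0) //; last first.
    - exact: sumr_ge0.
    - exact: deg_ge0 max_v0 iv.
    rewrite !mulf_eq0 !(gt_eqF b0, gt_eqF c0) /= subr_eq0.
    case/andP => /eqP <- /eqP/psumr_eq0P edge0; split=> // e eE ie.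
    by apply/eqP; rewrite -subr_eq0 edge0 ?eE.
  have degE i : i != v0 -> deg E i = maxdeg2 E.
    by move=> /rowE [/eqP]; rewrite eqr_nat => /eqP.
  (* For [d = 1] the root equation reads [D' - D = 0], so [v0] shares the degree of the other
     vertices. *)
  have [dE | dN] := eqVneq d 1.
    left; have DD' : D = D'.
      by apply/eqP; rewrite eq_sym -subr_eq0 -(hpoly1 (k := k) (a := a)) -dE d_root.
    suff deg_all i : deg E i = maxdeg2 E by move=> i j; rewrite !deg_all.
    have [->|/degE //] := eqVneq i v0.
    by rewrite -(maxdeg_max max_v0); apply/eqP; rewrite -(eqr_nat C) -/D DD'.
  (* An edge avoiding [v0] would contain another vertex, whose row condition forces [d = 1]. *)
  right; apply: (cone_of_apex unifE _ degE) => e eE.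
  apply/negPn/negP => v0e; have : (0 < #|e|)%N by rewrite unifE // ltnW.
  case/card_gt0P => i ie; have iv : i != v0 by apply: contraNneq v0e => <-.
  have [_ /(_ e eE ie)] := rowE i iv.
  by rewrite (negPf v0e) => /eqP; rewrite (negPf dN).
case=> [regE | [H [_ [regH /(apex_of_cone regH) [v [vE degE]]]]]].
  have [u _ degu] := maxdeg2_attained max_v0 n2.
  have dE : d = 1 by apply: diag; rewrite /D (maxdeg_max max_v0) (regE _ u) degu.
  apply: (eigen v0 max_v0) => [i _ | e _]; last by rewrite dE; case: ifP.
  by rewrite (regE i u) degu.
(* The apex of the cone lies in every edge, so its degree is maximal and it can carry the weight [d]
   in place of [v0]. *)
have max_v u : (deg E u <= deg E v)%N.
  by apply/subset_leq_card/subsetP => e; rewrite !inE => /andP [eE _]; rewrite eE vE.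
have [u uv degu] := maxdeg2_attained max_v n2.
apply: (eigen v max_v) => [i iv | e eE]; last by rewrite vE.
by rewrite (degE i u iv uv) degu.
Qed.
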